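(* Let $n\ge 1$ be an integer and $C$ a real number. Let $\mu$ be a nondegenerate probability measure on the braid group $B(n+1)$; if $n+1=3$, assume moreover that $\mu(\sigma_i)\neq 0$ and $\mu(\sigma_i^{-1})\neq 0$ for $i=1,2$. Denote by $\hat\beta$ the closure of a braid $\beta$. The following hold for the right random $\mu$-walk. 1. If $n+1$ is odd, the set $\{\beta\in B(n+1): |\det(\hat{\beta})|<C\}$ is transient. 2. If $n+1$ is even, then (a) the set $\{\beta\in B(n+1): 0<|\det(\hat{\beta})|<C\}$ is transient; (b) the set $\{\beta\in B(n+1): \beta \text{ closes into a knot and } |\det(\hat{\beta})|<C\}$ is transient.
   Context: $B(n+1)$ is the group of braids with $n+1$ strands, with standard generators $\sigma_1,\dots,\sigma_n$. Determinant of a link: if $L\subset\mathbb{S}^3$ is a link with Seifert matrix $V$ (matrix of the Seifert form of a Seifert surface of $L$), then $\det(L)=\det(V+{}^tV)$; up to sign it equals $\Delta_L(-1)$, where $\Delta_L$ is the Alexander polynomial. Random walks. Probability measures are taken with finite support. The convolution of probability measures on a discrete group $G$ is $(\mu_1\star\mu_2)(g)=\sum_{h\in G}\mu_1(gh^{-1})\mu_2(h)$, and $\mu^{\star k}$ is the $k$-fold convolution of $\mu$ with itself. A probability measure $\mu$ on $G$ is nondegenerate if $\mathrm{supp}(\mu)$ generates $G$ as a semigroup. The right random $\mu$-walk is the Markov chain starting at the identity, whose probability of being in a subset $S\subset G$ at the $k$-th step is $\mu^{\star k}(S)$. A subset $S\subset G$ is transient for this walk if $\mu^{\star k}(S)\to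 0$ as $k\to\infty$. *)

(* Defs.v *)
From HB Require Import structures.
From mathcomp Require Import all_boot all_order all_algebra all_fingroup.
From mathcomp Require Import zify.
From mathcomp Require Import boolp classical_sets functions cardinality fsbigop.
From mathcomp Require Import reals topology normedtype sequences.

Set Implicit Arguments.
Unset Strict Implicit.
Unset Printing Implicit Defensive.

Import Order.TTheory GRing.Theory Num.Theory.
Import numFieldNormedType.Exports.

Local Open Scope classical_set_scope.
Local Open Scope ring_scope.

(** * Braid groups *)

(** The letter [(i, true)] is the positive crossing exchanging the strands [i]
    and [i + 1], counted from 0 (so it is sigma_{i+1} in the usual numbering);
    [(i, false)] is its inverse. There are [n] generators and [n + 1] strands. *)
Definition braid_word (n : nat) := seq ('I_n * bool).

(** Artin's presentation. *)
Inductive braid_rel (n : nat) : braid_word n -> braid_word n -> Prop :=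
| braid_rel_refl u : braid_rel u u
| braid_rel_sym u v : braid_rel u v -> braid_rel v u
| braid_rel_trans u v w : braid_rel u v -> braid_rel v w -> braid_rel u w
| braid_rel_cat u u' v v' :
    braid_rel u u' -> braid_rel v v' -> braid_rel (u ++ v) (u' ++ v')
| braid_rel_cancel i b : braid_rel [:: (i, b); (i, ~~ b)] [::]
| braid_rel_comm (i j : 'I_n) : (i.+1 < j)%N ->
    braid_rel [:: (i, true); (j, true)] [:: (j, true); (i, true)]
| braid_rel_braid (i j : 'I_n) : j = i.+1 :> nat ->
    braid_rel [:: (i, true); (j, true); (i, true)]
              [:: (j, true); (i, true); (j, true)].

Section BraidGroup.
Variable n : nat.
Implicit Types u v w : braid_word n.

Definition braid_relb u v : bool := `[< braid_rel u v >].

Lemma braid_relb_refl : reflexive braid_relb.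
Proof. by move=> u; apply/asboolP; exact: braid_rel_refl. Qed.

Lemma braid_relb_sym : symmetric braid_relb.
Proof.
by move=> u v; apply/asboolP/asboolP => h; exact: braid_rel_sym h.
Qed.

Lemma braid_relb_trans : transitive braid_relb.
Proof.
move=> v u w /asboolP uv /asboolP vw; apply/asboolP.
exact: braid_rel_trans uv vw.
Qed.

Canonical braid_equiv :=
  EquivRel braid_relb braid_relb_refl braid_relb_sym braid_relb_trans.

(** The braid group B(n+1). *)
Definition braid := {eq_quot braid_equiv}%qT.
HB.instance Definition _ := Choice.on braid.

Definition braid_of (w : braid_word n) : braid := (\pi_braid w)%qT.

Lemma braid_ofP u v : (braid_of u = braid_of v) <-> braid_rel u v.
Proof.
split; first by move/eqmodP/asboolP.
by move=> h; apply/eqmodP/asboolP.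
Qed.

Definition braid_repr (x : braid) : braid_word n :=
  generic_quotient.repr x.

Lemma braid_reprK : cancel braid_repr braid_of.
Proof. exact: reprK. Qed.

Lemma braid_repr_rel w : braid_rel (braid_repr (braid_of w)) w.
Proof. by apply/braid_ofP; rewrite braid_reprK. Qed.

Definition word_inv w : braid_word n := rev [seq (a.1, ~~ a.2) | a <- w].

Lemma word_invK : involutive word_inv.
Proof.
move=> w; rewrite /word_inv map_rev revK -map_comp -[RHS]map_id.
by apply: eq_map => -[i b] /=; rewrite negbK.
Qed.

Lemma word_mulVw w : braid_rel (word_inv w ++ w) [::].
Proof.
elim: w => [|[i b] w ih]; first exact: braid_rel_refl.
rewrite /word_inv /= rev_cons cat_rcons -/(word_inv w).
apply: braid_rel_trans ih.
apply: braid_rel_cat; first exact: braid_rel_refl.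
rewrite -[_ :: _ :: w]/([:: (i, ~~ b); (i, b)] ++ w) -[w in X in braid_rel _ X]cat0s.
apply: braid_rel_cat; last exact: braid_rel_refl.
by rewrite -{2}(negbK b); exact: braid_rel_cancel.
Qed.

Lemma word_mulwV w : braid_rel (w ++ word_inv w) [::].
Proof. by have := word_mulVw (word_inv w); rewrite word_invK. Qed.

Definition braid_mul (x y : braid) := braid_of (braid_repr x ++ braid_repr y).
Definition braid_inv (x : braid) := braid_of (word_inv (braid_repr x)).

Lemma braid_mul_of u v : braid_mul (braid_of u) (braid_of v) = braid_of (u ++ v).
Proof. by apply/braid_ofP; apply: braid_rel_cat; exact: braid_repr_rel. Qed.

Lemma braid_mulA : associative braid_mul.
Proof.
move=> x y z; rewrite -[x]braid_reprK -[y]braid_reprK -[z]braid_reprK.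
by rewrite !braid_mul_of catA.
Qed.

Lemma braid_mul1 : left_id (braid_of [::]) braid_mul.
Proof. by move=> x; rewrite -[x]braid_reprK braid_mul_of. Qed.

Lemma braid_mulr1 : right_id (braid_of [::]) braid_mul.
Proof. by move=> x; rewrite -[x]braid_reprK braid_mul_of cats0. Qed.

Lemma braid_mulV : left_inverse (braid_of [::]) braid_inv braid_mul.
Proof.
move=> x; rewrite -{2}[x]braid_reprK braid_mul_of.
by apply/braid_ofP; exact: word_mulVw.
Qed.

Lemma braid_mulrV : right_inverse (braid_of [::]) braid_inv braid_mul.
Proof.
move=> x; rewrite -{1}[x]braid_reprK braid_mul_of.
by apply/braid_ofP; exact: word_mulwV.
Qed.

HB.instance Definition _ := isGroup.Build braid
  braid_mulA braid_mul1 braid_mulr1 braid_mulV braid_mulrV.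

Lemma braid_ofM u v : braid_of (u ++ v) = (braid_of u * braid_of v)%g.
Proof. by rewrite -braid_mul_of. Qed.

Definition sigma (i : 'I_n) : braid := braid_of [:: (i, true)].

Lemma sigmaV (i : 'I_n) : ((sigma i)^-1)%g = braid_of [:: (i, false)].
Proof.
apply: (can_inj (mulgK (sigma i))); rewrite mulVg -braid_ofM.
by apply/esym/braid_ofP; exact: (braid_rel_cancel i false).
Qed.

End BraidGroup.

(** * Closed braids *)

Section Closure.
Variable n : nat.
Implicit Types (w : braid_word n) (b : braid n).

Definition word_perm w : {perm 'I_n.+1} :=
  (\prod_(a <- w) tperm (inord a.1) (inord a.1.+1))%g.

Definition braid_perm b : {perm 'I_n.+1} := word_perm (braid_repr b).

Lemma tperm_inord_fix (i j : nat) (k : 'I_n.+1) :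
  (i <= n)%N -> (j <= n)%N -> k != i :> nat -> k != j :> nat ->
  tperm (inord i) (inord j) k = k.
Proof.
move=> lei lej ki kj; apply: tpermD; apply/eqP => /(congr1 val) /=;
by rewrite inordK // => e; move: ki kj; rewrite e eqxx.
Qed.

Lemma word_perm_rel w w' : braid_rel w w' -> word_perm w = word_perm w'.
Proof.
elim => {w w'} [//|u v _ ->//|u v w _ -> _ ->//|u u' v v' _ hu _ hv|i b|i j ij|i j ij].
- by rewrite /word_perm !big_cat /= -!/(word_perm _) hu hv.
- by rewrite /word_perm !big_cons big_nil /= mulg1 tperm2.
- have [ltin ltjn] := (ltn_ord i, ltn_ord j).
  rewrite /word_perm !big_cons big_nil /= !mulg1.
  set s := tperm _ _; set t := tperm _ _.
  suff st : (s ^ t)%g = s by rewrite -{2}st conjgE !mulgA mulgV mul1g.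
  have lt1 : (i.+1 < n.+1)%N by [].
  rewrite /s tpermJ !tperm_inord_fix //; rewrite ?inordK ?(ltnW ltin) // ?(ltnW lt1) //; lia.
- have [ltin ltjn] := (ltn_ord i, ltn_ord j).
  rewrite /word_perm !big_cons big_nil /= !mulg1 -ij.
  set s := tperm _ _; set t := tperm _ _.
  have -> : (s * (t * s) = t ^ s)%g by rewrite conjgE tpermV.
  have -> : (t * (s * t) = s ^ t)%g by rewrite conjgE tpermV.
  rewrite /s /t !tpermJ tpermR tpermL !tperm_inord_fix //;
    rewrite ?inordK //; lia.
Qed.

Lemma braid_perm_of w : braid_perm (braid_of w) = word_perm w.
Proof. exact/word_perm_rel/braid_repr_rel. Qed.

(** The components of the closure are the orbits of the strand endpoints. *)
Definition closes_into_knot b : Prop := #|porbits (braid_perm b)| = 1%N.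

(** Seifert's algorithm applied to the closure of the word [w] gives the surface
    made of [n + 1] parallel disks, numbered upwards, and one half-twisted band
    for each letter of [w], the letter [(i, _)] joining the disks [i] and [i + 1];
    the bands are met in the order of [w] when turning counterclockwise around
    the axis of the closure. The disks and bands are the vertices and edges of a
    graph onto which the surface retracts, with the following incidence matrix
    (edges oriented upwards). *)
Definition seifert_boundary w : 'M[int]_(size w, n.+1) :=
  \matrix_(k, j) let i := (tnth (in_tuple w) k).1 in
    ((j == i.+1 :> nat)%:R - (j == i :> nat)%:R).

(** The rows of [B] are a Z-basis of the first homology group of the surface,
    seen as the group of cycles of the above graph. *)
Definition seifert_basis w r (B : 'M[int]_(r, size w)) : Prop :=
  forall x : 'rV[int]_(size w),
    x *m seifert_boundary w = 0 <-> exists! u : 'rV[int]_r, x = u *m B.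

(** The matrix, on the edges, of a bilinear form whose restriction to the cycles
    is the Seifert form [(x, y) |-> lk(x, y^+)], with [y^+] the push-off of [y] on
    the upper side of the disks. For [x] through bands between the disks [i] and
    [i + 1] and [y] through bands between the disks [j] and [j + 1], count with
    signs the crossings, seen from above, where [x] passes over [y^+]. Each of [x]
    and [y] follows two opposite chords, one on each disk. Outside the bands,
    - if [i < j], then [x] is below [y^+] and there is no crossing;
    - if [i = j], the upper chord of [x] passes over the lower chord of [y^+];
    - if [i = j + 1], the contributions cancel except that of the lower chord of
      [x] (on the disk [j + 1]) over the lower chord of [y^+], whence the sign;
    - if [i > j + 1], all contributions cancel.
    The last term accounts for the half-twists: the form takes the value
    [- (e + e') / 2] on a cycle through two bands of signs [e] and [e']. *)
Definition seifert_chain_form w : 'M[int]_(size w) :=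
  \matrix_(k, l) let: (i, e) := tnth (in_tuple w) k in
                 let: (j, _) := tnth (in_tuple w) l in
    (l < k)%N%:R * ((i == j)%:R - (i == j.+1 :> nat)%:R)
      + ((k == l) && ~~ e)%:R.

(** [V] is a Seifert matrix of the closure of [b]. The surface obtained from a
    word is connected if and only if every generator occurs in the word. *)
Definition seifert_matrix b r (V : 'M[int]_r) : Prop :=
  exists w : braid_word n,
    [/\ braid_of w = b,
        forall i : 'I_n, i \in [seq a.1 | a <- w] &
        exists2 B : 'M[int]_(r, size w),
          seifert_basis B & V = B *m seifert_chain_form w *m B^T].

(** The sign of the determinant depends on the choice of a Seifert surface; its
    absolute value is an invariant of the link. *)
Definition closure_det b : int :=
  xget 0 [set d | exists r (V : 'M[int]_r), seifert_matrix b V /\ d = \det (V + V^T)].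

Lemma seifert_basis_exists w : exists r (B : 'M[int]_(r, size w)), seifert_basis B.
Proof.
set M := seifert_boundary w; have [L uL [R uR [d _ defM]]] := int_Smith_normal_form M.
set D := \matrix_(i, j) _ in defM.
pose I := [set k : 'I_(size w) | [forall j : 'I_n.+1, D k j == 0]]%SET.
pose B := rowsub (fun a : 'I_#|I| => enum_val a) (invmx L).
exists #|I|, B => x.
have kerP : x *m M = 0 <-> forall k, k \notin I -> (x *m L) 0 k = 0.
  rewrite defM !mulmxA; split=> [h k kI|h].
    have {}h : x *m L *m D = 0.
      by rewrite -[x *m L *m D](mulmxK uR) h mul0mx.
    move: kI; rewrite inE negb_forall => /existsP[j Dkj].
    move/matrixP/(_ 0 j): h; rewrite mxE (bigD1 k) //= big1 => [|k' k'k].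
      by rewrite addr0 [RHS]mxE => /eqP; rewrite mulf_eq0 (negbTE Dkj) orbF => /eqP.
    have kj : k = j :> nat.
      by move: Dkj; rewrite mxE; have [|_] := eqVneq (k : nat) j; rewrite ?mulr0n ?eqxx.
    by rewrite [D _ _]mxE -kj (inj_eq val_inj) (negbTE k'k) mulr0.
  suff -> : x *m L *m D = 0 by rewrite mul0mx.
  apply/matrixP => i j; rewrite ord1 !mxE big1 // => k _.
  have [kI|kI] := boolP (k \in I); last by rewrite h // mul0r.
  by move: kI; rewrite inE => /forallP/(_ j)/eqP ->; rewrite mulr0.
have uB u : u *m B *m L = \row_k \sum_(a < #|I|) u 0 a * (enum_val a == k)%:R.
  rewrite /B -mulmxA mul_rowsub_mx mulVmx //; apply/rowP => k; rewrite !mxE.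
  by apply: eq_bigr => a _; rewrite !mxE.
have uB_in (u : 'rV_#|I|) a : (u *m B *m L) 0 (enum_val a) = u 0 a.
  rewrite uB mxE (bigD1 a) //= eqxx mulr1 big1 ?addr0 // => a' a'a.
  by rewrite (inj_eq enum_val_inj) (negbTE a'a) mulr0.
rewrite kerP; split=> [h|[u [-> _]] k kI]; last first.
  rewrite uB mxE big1 // => a _; case: eqP => [e|]; last by rewrite mulr0.
  by rewrite -e enum_valP in kI.
exists (\row_a (x *m L) 0 (enum_val a)); split=> [|u ->]; last first.
  by apply/rowP => a; rewrite mxE uB_in.
apply: (can_inj (mulmxK uL)); apply/rowP => k.
have [kI|kI] := boolP (k \in I).
  by have -> : k = enum_val (enum_rank_in kI k) by [rewrite enum_rankK_in]; rewrite uB_in [RHS]mxE.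
rewrite h // uB mxE big1 // => a _; case: eqP => [e|]; last by rewrite mulr0.
by rewrite -e enum_valP in kI.
Qed.

Lemma seifert_matrix_exists b : exists r (V : 'M[int]_r), seifert_matrix b V.
Proof.
pose v := flatten [seq [:: (i, true); (i, false)] | i <- enum 'I_n].
have hv : braid_rel v [::].
  rewrite /v; elim: (enum _) => [|i s ih]; first exact: braid_rel_refl.
  by apply: (@braid_rel_cat _ [:: _; _] [::] _ [::]) => //; exact: braid_rel_cancel.
pose w := braid_repr b ++ v.
have [r [B hB]] := seifert_basis_exists w.
exists r, (B *m seifert_chain_form w *m B^T), w; split; last by exists B.
  rewrite -[RHS]braid_reprK; apply/braid_ofP.
  rewrite -[X in braid_rel _ X]cats0; apply: braid_rel_cat => //.
  exact: braid_rel_refl.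
move=> i; rewrite map_cat mem_cat; apply/orP; right; apply/mapP.
exists (i, true) => //; apply/flattenP.
exists [:: (i, true); (i, false)]; last by rewrite mem_head.
by apply/mapP; exists i; rewrite ?mem_enum.
Qed.

Lemma closure_detP b :
  exists r (V : 'M[int]_r), seifert_matrix b V /\ closure_det b = \det (V + V^T).
Proof.
apply: (@xgetPex _ 0
  [set d | exists r (V : 'M[int]_r), seifert_matrix b V /\ d = \det (V + V^T)]).
have [r [V hV]] := seifert_matrix_exists b.
by exists (\det (V + V^T)), r, V.
Qed.

End Closure.

(** * Random walks on a discrete group *)

Section RandomWalk.
Variables (R : realType) (G : groupType).
Implicit Types (mu : G -> R) (S : set G).

(** Sums [\sum_(g \in S) f g] range over the support of [f] in [S], which is
    finite in all the uses below. *)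
Record finite_probability mu : Prop := FiniteProbability {
  fprob_ge0 : forall g, 0 <= mu g;
  fprob_supp : finite_set [set g | mu g != 0];
  fprob_sum : \sum_(g \in [set: G]) mu g = 1 }.

Definition convolution (mu1 mu2 : G -> R) : G -> R :=
  fun g => \sum_(h \in [set: G]) mu1 (g * h^-1)%g * mu2 h.

Definition conv_pow mu (k : nat) : G -> R :=
  iter k (fun nu => convolution nu mu) (fun g => (g == 1%g)%:R).

Definition nondegenerate_probability mu : Prop :=
  forall g : G, exists s : seq G,
    [/\ s != [::], all (fun h => mu h != 0) s & g = (\prod_(h <- s) h)%g].

Definition transient mu S : Prop :=
  (fun k => \sum_(g \in S) conv_pow mu k g) @ \oo --> (0 : R).

End RandomWalk.

(* Main.v *)
Require Import Defs.
From mathcomp Require Import all_boot all_order all_algebra all_fingroup.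
From mathcomp Require Import zify ring lra finmap.
From mathcomp Require Import boolp classical_sets functions cardinality fsbigop.
From mathcomp Require Import reals topology normedtype sequences.

(** Write w for a braid word on the generators 0, ..., n - 1 and omega for the skew
    form of a chain of n curves of which consecutive ones meet once. The Burau
    representation at t = -1 sends the generator i to the transvection
    1 + omega E_ii, so the matrix of w has the form 1 - omega x with x an n x n
    integer matrix, and composing braids becomes the law (x, y) |-> x + y - y omega x.
    Keeping x rather than 1 - omega x loses nothing when omega is singular, that is
    when n is odd, and the parity of n disappears from the argument. Two facts about
    x, the variation of the braid, are used.

    First, the determinant of the closure is, up to sign, det x
    ([closure_det_variation]). On cycles, the symmetrized Seifert form of a word
    agrees with a triangular form having signs on its diagonal; the cycles are the
    kernel of the matrix sending each band to its generator; and by Jacobi's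
    complementary minor formula the determinant on this kernel equals, up to sign, a
    determinant of size n built from the inverse of the triangular form. Solving
    the triangular system band by band reproduces the recursion defining x.

    Secondly, x^T - x = x omega x^T. Reduce modulo a large prime p, and let H be the
    finite set of variations modulo p. Multiplying a braid by the k-th power of a
    generator adds to x a rank one matrix proportional to k, so det x is affine in k,
    hence multi-affine along any sequence of generators. The identity above implies
    that along a fixed sequence of n(n+1) generators this function is never constant,
    whatever the starting point ([det_constant_false]). As a nonconstant affine
    function takes each value at most once, a union bound over the sequence shows
    that each value is taken by det on a proportion at most n(n+1)/p of H
    ([card_det_levels]).

    Finally, let s be the length of some nonempty product of elements of the support
    of mu equal to the identity; it is independent of p. The walk pushed to H gives
    each point a mass whose upper limit is at most s/|H| ([fiber_mass_limsup]): the
    largest mass contracts towards this value, the factor s accounting for a possible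
    periodicity. Hence the limsup of the probability that |det| < C is O(1/p), for
    every p, for both parities of n. The two sets of the even case are contained
    in that one. *)

Set Implicit Arguments.
Unset Strict Implicit.
Unset Printing Implicit Defensive.

Import Order.TTheory GRing.Theory Num.Theory.
Import numFieldNormedType.Exports.

Local Open Scope ring_scope.

(** * The variation matrix of a braid *)

Lemma addmx_entry (F : nmodType) m n (x y : 'M[F]_(m, n)) i j :
  (x + y) i j = x i j + y i j.
Proof. by rewrite mxE. Qed.

Lemma oppmx_entry (F : zmodType) m n (x : 'M[F]_(m, n)) i j : (- x) i j = - x i j.
Proof. by rewrite mxE. Qed.

Definition entrywise := (addmx_entry, oppmx_entry).

Section Variation.
Variables (F : comNzRingType) (n : nat).
Implicit Types (x y z : 'M[F]_n) (u v w : braid_word n) (i j : 'I_n).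

(** The intersection form of a chain of [n] simple closed curves, the Dehn twists
    along which satisfy the braid relations. *)
Definition chain_form : 'M[F]_n :=
  \matrix_(i, j) ((j == i.+1 :> nat)%:R - (i == j.+1 :> nat)%:R).

(** The law that makes [x |-> 1 - chain_form *m x] reverse products:
    [(1 - omega y) (1 - omega x) = 1 - omega (x + y - y omega x)]. *)
Definition variation_mul x y := x + y - y *m chain_form *m x.

Definition letter_variation (a : 'I_n * bool) : 'M[F]_n :=
  (-1) ^+ a.2 *: delta_mx a.1 a.1.

Definition variation w : 'M[F]_n :=
  foldl (fun x a => variation_mul x (letter_variation a)) 0 w.

Lemma tr_chain_form : chain_form^T = - chain_form.
Proof. by apply/matrixP => i j; rewrite !mxE opprB. Qed.

Lemma chain_form_diag i : chain_form i i = 0.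
Proof. by rewrite mxE subrr. Qed.

Lemma variation_mul0x x : variation_mul 0 x = x.
Proof. by rewrite /variation_mul mulmx0 subr0 add0r. Qed.

Lemma variation_mulx0 x : variation_mul x 0 = x.
Proof. by rewrite /variation_mul !mul0mx subr0 addr0. Qed.

Lemma variation_mulA : associative variation_mul.
Proof.
move=> x y z; rewrite /variation_mul !(mulmxDl, mulmxDr, mulmxBl, mulmxBr, mulmxN, mulNmx) !mulmxA.
by apply/matrixP => i j; rewrite !entrywise; ring.
Qed.

Lemma variation_rcons w a :
  variation (rcons w a) = variation_mul (variation w) (letter_variation a).
Proof. by rewrite /variation foldl_rcons. Qed.

Lemma variation_cat u v : variation (u ++ v) = variation_mul (variation u) (variation v).
Proof.
elim/last_ind: v => [|v a ih]; first by rewrite cats0 variation_mulx0.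
by rewrite -rcons_cat !variation_rcons ih variation_mulA.
Qed.

Lemma variation1 a : variation [:: a] = letter_variation a.
Proof. by rewrite /variation /= variation_mul0x. Qed.

Lemma delta_form (i j k l : 'I_n) (m : 'M[F]_n) :
  delta_mx i j *m m *m delta_mx k l = m j k *: delta_mx i l.
Proof.
apply/matrixP => a b; rewrite !mxE (bigD1 k) //= big1 ?addr0 => [|c ck]; last first.
  by rewrite [in X in _ * X]mxE (negbTE ck) mulr0.
rewrite !mxE (bigD1 j) //= big1 ?addr0 => [|c ck]; last by rewrite mxE (negbTE ck) andbF mul0r.
by rewrite !mxE !eqxx /= andbT; case: (a == i); case: (b == l);
  rewrite ?mulr0n ?mulr1n ?mul0r ?mul1r ?mulr0 ?mulr1.
Qed.

(** Two letters interact only through one entry of [chain_form], which is zero for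
    distant generators and a sign for consecutive ones. *)
Lemma letter_form a b :
  letter_variation a *m chain_form *m letter_variation b =
  ((-1) ^+ (a.2 (+) b.2) * chain_form a.1 b.1) *: delta_mx a.1 b.1.
Proof.
rewrite /letter_variation -scalemxAr -!scalemxAl delta_form !scalerA; congr (_ *: _).
by rewrite signr_addb; ring.
Qed.

(** The right-hand side is symmetric in [x] and [y], whence the braid relation. *)
Lemma variation_mul_braid x y :
    x *m chain_form *m x = 0 ->
    x *m chain_form *m y *m chain_form *m x = - x ->
  variation_mul (variation_mul x y) x = x + y - y *m chain_form *m x - x *m chain_form *m y.
Proof.
move=> xx xyx; rewrite /variation_mul !(mulmxDr, mulmxN) !mulmxA xx xyx add0r.
set p := y *m _ *m x; set q := x *m _ *m y.
by apply/matrixP => i j; rewrite !entrywise; ring.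
Qed.

Lemma variation_braid_rel u v : braid_rel u v -> variation u = variation v.
Proof.
elim=> {u v} [//|u v _ ->//|u v w _ -> _ ->//|u u' v v' _ hu _ hv|i b|i j ij|i j ij].
- by rewrite !variation_cat hu hv.
- rewrite (variation_cat [:: _]) !variation1 /variation_mul letter_form /= chain_form_diag.
  rewrite mulr0 scale0r subr0.
  by rewrite /letter_variation /= -scalerDl signrN subrr scale0r.
- have c0 : chain_form i j = 0.
    by rewrite mxE; case: eqP => [|_]; [lia|case: eqP => [|_]; [lia|rewrite subrr]].
  have c0' : chain_form j i = 0.
    by rewrite mxE; case: eqP => [|_]; [lia|case: eqP => [|_]; [lia|rewrite subrr]].
  rewrite !(variation_cat [:: _] [:: _]) !variation1 /variation_mul !letter_form /= c0 c0'.
  rewrite !mulr0 !scale0r.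
  by rewrite !subr0 addrC.
- have cij : chain_form i j = 1 by rewrite mxE -ij eqxx; case: eqP => [?|_]; [lia|rewrite subr0].
  have cji : chain_form j i = -1 by rewrite mxE -ij eqxx; case: eqP => [?|_]; [lia|rewrite sub0r].
  have aba k l : chain_form k l * chain_form l k = -1 ->
      letter_variation (k, true) *m chain_form *m letter_variation (l, true)
        *m chain_form *m letter_variation (k, true) = - letter_variation (k, true).
    move=> ckl; rewrite letter_form /= mul1r -scalemxAl -scalemxAl /letter_variation -scalemxAr.
    by rewrite delta_form !scalerA mulrAC ckl mulN1r scaleNr.
  have aa k : letter_variation (k, true) *m chain_form *m letter_variation (k, true) = 0.
    by rewrite letter_form /= chain_form_diag mulr0 scale0r.
  rewrite !(variation_cat [:: _; _] [:: _]) !(variation_cat [:: _] [:: _]) !variation1.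
  rewrite !variation_mul_braid ?aa ?aba ?cij ?cji ?mulr1 ?mul1r //.
  by rewrite addrAC [letter_variation (j, true) + _]addrC.
Qed.

(** The variations lie in an algebraic group for the law [variation_mul], whose tangent
    space at 0 consists of the symmetric matrices; this equation integrates the
    symmetry. On an invertible [x] it prescribes the antisymmetric part of [x^-1]
    ([invmx_symmetric]). *)
Definition seifert_symmetric x := x^T - x = x *m chain_form *m x^T.

Lemma seifert_symmetric_mul x y :
  seifert_symmetric x -> seifert_symmetric y -> seifert_symmetric (variation_mul x y).
Proof.
rewrite /seifert_symmetric => hx hy.
have -> : (variation_mul x y)^T = x^T + y^T + x^T *m chain_form *m y^T.
  by rewrite /variation_mul !raddfD /= raddfN /= !trmx_mul tr_chain_form mulNmx mulmxN opprK mulmxA.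
rewrite /variation_mul !(mulmxDl, mulmxDr, mulmxBl, mulmxBr, mulmxN, mulNmx) !mulmxA.
have hx1 m : m *m x *m chain_form *m x^T = m *m x^T - m *m x.
  by rewrite -!mulmxA [x *m _]mulmxA -hx mulmxBr.
rewrite -hx -hy !hx1 !mulmxBl.
by apply/matrixP => i j; rewrite !entrywise; ring.
Qed.

Lemma seifert_symmetric_diag c i : seifert_symmetric (c *: delta_mx i i).
Proof.
rewrite /seifert_symmetric linearZ /= trmx_delta subrr.
by rewrite -scalemxAr -!scalemxAl delta_form chain_form_diag scale0r !scaler0.
Qed.

Lemma seifert_symmetric_variation w : seifert_symmetric (variation w).
Proof.
elim/last_ind: w => [|w a ih].
  by rewrite /seifert_symmetric /variation /= trmx0 subrr !mul0mx.
by rewrite variation_rcons; apply: seifert_symmetric_mul => //; apply: seifert_symmetric_diag.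
Qed.

End Variation.

Lemma map_chain_form (F F' : comNzRingType) (f : {rmorphism F -> F'}) n :
  map_mx f (chain_form F n) = chain_form F' n.
Proof. by apply/matrixP => i j; rewrite !mxE rmorphB /= !rmorph_nat. Qed.

Lemma map_variation (F F' : comNzRingType) (f : {rmorphism F -> F'}) n (w : braid_word n) :
  map_mx f (variation F w) = variation F' w.
Proof.
elim/last_ind: w => [|w a ih]; first by rewrite /variation /= map_mx0.
rewrite !variation_rcons -ih /variation_mul map_mxB map_mxD !map_mxM map_chain_form.
by rewrite /letter_variation map_mxZ rmorphXn rmorphN1 map_delta_mx.
Qed.

Section BraidVariation.
Variables (F : comNzRingType) (n : nat).

Definition braid_variation (b : braid n) : 'M[F]_n := variation F (braid_repr b).

Lemma braid_variation_of w : braid_variation (braid_of w) = variation F w.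
Proof. exact/variation_braid_rel/braid_repr_rel. Qed.

Lemma braid_variationM b b' :
  braid_variation (b * b')%g = variation_mul (braid_variation b) (braid_variation b').
Proof.
rewrite -[b in LHS]braid_reprK -[b' in LHS]braid_reprK -braid_ofM.
by rewrite braid_variation_of variation_cat.
Qed.

End BraidVariation.

(** * The determinant of a closed braid *)

Lemma delta_mx_mulE (F : pzRingType) m n p (A : 'M[F]_(n, p)) (a : 'I_m) b i j :
  (delta_mx a b *m A) i j = (a == i)%:R * A b j.
Proof.
rewrite mxE (bigD1 b) //= big1 ?addr0 => [|c /negbTE cb]; last by rewrite mxE cb andbF mul0r.
by rewrite mxE eqxx andbT eq_sym.
Qed.

(** Jacobi's formula: [W] times [W'] with its left columns replaced by those of the
    identity is block triangular. *)
Lemma det_complementary_minor (F : comNzRingType) r n (W W' : 'M[F]_(r + n)) :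
  W *m W' = 1%:M -> \det (ulsubmx W) = \det W * \det (drsubmx W').
Proof.
move=> WW'; pose Z := block_mx 1%:M (ursubmx W') 0 (drsubmx W').
have WZ : W *m Z = block_mx (ulsubmx W) 0 (dlsubmx W) 1%:M.
  rewrite -[in LHS](submxK W) /Z mulmx_block.
  move: WW'; rewrite -[in X in X -> _](submxK W) -[in X in X -> _](submxK W') mulmx_block.
  rewrite (scalar_mx_block r n 1) => /eq_block_mx[_ -> _ ->].
  by rewrite !mulmx1 !mulmx0 !addr0.
by move: (congr1 determinant WZ); rewrite det_mulmx det_ublock det1 mul1r det_lblock det1 mulr1.
Qed.

Section KernelBasis.
Variables (F : pzRingType) (r N n : nat) (B : 'M[F]_(r, N)) (D : 'M[F]_(N, n)).
Hypothesis kerD : forall x : 'rV_N, x *m D = 0 <-> exists! u : 'rV_r, x = u *m B.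

Lemma kernel_basis_inj m : injective (fun X : 'M_(m, r) => X *m B).
Proof.
move=> X Y XY; apply/row_matrixP => i; apply/subr0_eq.
have /kerD[u [_ uniq0]] : (0 : 'rV_N) *m D = 0 by rewrite mul0mx.
have -> : row i X - row i Y = u.
  by apply/esym/uniq0; rewrite mulmxBl -!row_mul XY subrr.
by apply: uniq0; rewrite mul0mx.
Qed.

Lemma kernel_basis_mul0 : B *m D = 0.
Proof.
apply/row_matrixP => i; rewrite row_mul row0; apply/kerD; exists (delta_mx 0 i).
by rewrite rowE; split=> // u /kernel_basis_inj.
Qed.

End KernelBasis.

(** A basis [B] of the kernel of the surjection [D] and a section [C] of [D] form a
    unimodular matrix. In this basis of the lattice, the restriction of the form [Q]
    to the kernel is a block of [Q], and the right-hand side is the complementary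
    block of its inverse. *)
Lemma det_kernel_form r N n (B : 'M[int]_(r, N)) (D : 'M[int]_(N, n))
    (C : 'M[int]_(n, N)) (Q : 'M[int]_N) :
    C *m D = 1%:M -> Q \in unitmx ->
    (forall x : 'rV_N, x *m D = 0 <-> exists! u : 'rV_r, x = u *m B) ->
  `|\det (B *m Q *m B^T)| = `|\det (D^T *m invmx Q *m D)|.
Proof.
move=> CD uQ kerD.
have BD := kernel_basis_mul0 kerD; have freeB := kernel_basis_inj kerD.
have [B' B'B] : exists B' : 'M_(N, r), B' *m B = 1%:M - D *m C.
  have h (k : 'I_N) : exists u : 'rV_r, row k (1%:M - D *m C) = u *m B.
    suff /kerD[u [? _]] : row k (1%:M - D *m C) *m D = 0 by exists u.
    by rewrite -row_mul mulmxBl mul1mx -mulmxA CD mulmx1 subrr row0.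
  have [f fB] := choice h.
  by exists (\matrix_k f k); apply/row_matrixP => k; rewrite row_mul rowK fB.
have BB' : B *m B' = 1%:M.
  by apply: freeB; rewrite -mulmxA B'B mulmxBr mulmx1 mulmxA BD mul0mx subr0 mul1mx.
have CB' : C *m B' = 0.
  by apply: freeB; rewrite -mulmxA B'B mulmxBr mulmx1 mulmxA CD mul1mx subrr mul0mx.
pose P := col_mx B C; pose P' := row_mx B' D.
have P'P : P' *m P = 1%:M by rewrite mul_row_col B'B subrK.
have PP' : P *m P' = 1%:M.
  by rewrite mul_col_row BB' BD CB' CD -scalar_mx_block.
pose W := P *m Q *m P^T; pose W' := P'^T *m invmx Q *m P'.
have WW' : W *m W' = 1%:M.
  rewrite /W /W' !mulmxA -[_ *m P^T *m P'^T]mulmxA -trmx_mul P'P trmx1 mulmx1.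
  by rewrite -[_ *m Q *m _]mulmxA mulmxV // mulmx1.
have nW : `|\det W| = 1.
  have [+ _] := mulmx1_unit WW'; rewrite unitmxE qualifE /=.
  by case/orP=> /eqP ->; rewrite ?normrN normr1.
have := det_complementary_minor WW'.
have -> : ulsubmx W = B *m Q *m B^T.
  by rewrite /W /P mul_col_mx tr_col_mx mul_col_row block_mxKul.
have -> : drsubmx W' = D^T *m invmx Q *m D.
  by rewrite /W' /P' tr_row_mx mul_col_mx mul_col_row block_mxKdr.
by move=> ->; rewrite normrM nW mul1r.
Qed.

Section Seifert.
Variables (n : nat) (w : braid_word n).
Local Notation N := (size w).
Local Notation ltr := (tnth (in_tuple w)).

Definition band_column : 'M[int]_(N, n) := \matrix_(k, i) ((ltr k).1 == i)%:R.

Lemma seifert_boundaryE :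
  seifert_boundary w =
  band_column *m \matrix_(i < n, j < n.+1) ((j == i.+1 :> nat)%:R - (j == i :> nat)%:R).
Proof.
apply/matrixP => k j; rewrite !mxE (bigD1 (ltr k).1) //= big1 ?addr0 => [|i /negbTE ik].
  by rewrite !mxE eqxx mul1r.
by rewrite !mxE [_ == i]eq_sym ik mul0r.
Qed.

(** The boundary of a band between the disks [i] and [i + 1] is the difference of two
    consecutive basis vectors. These [n] differences are independent, so a chain is a
    cycle if and only if its coefficients over each generator add up to 0. *)
Lemma boundary_kernel (x : 'rV[int]_N) : x *m seifert_boundary w = 0 <-> x *m band_column = 0.
Proof.
rewrite seifert_boundaryE mulmxA; set J := \matrix_(i, j) _.
split=> [|->]; last by rewrite mul0mx.
(* K expresses the vertices in terms of the differences, the last vertex being 0. *)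
pose K : 'M[int]_(n.+1, n) := \matrix_(j, i) - (j <= i)%N%:R.
have JK : J *m K = 1%:M.
  apply/matrixP => i i'; rewrite !mxE.
  have i1n : (i.+1 < n.+1)%N by rewrite ltnS.
  have i0n : (i < n.+1)%N by rewrite ltnW.
  rewrite (bigD1 (Ordinal i1n)) //= (bigD1 (Ordinal i0n)) //=; last first.
    by rewrite -val_eqE /=; lia.
  rewrite big1 ?addr0 => [|j].
    rewrite !mxE /= !eqxx -val_eqE /=; case: (ltngtP i i'); lia.
  rewrite -!val_eqE /= => /andP[/negbTE j1 /negbTE j0].
  by rewrite !mxE j1 j0 subrr mul0r.
by move/(congr1 (mulmx^~ K)); rewrite mul0mx -mulmxA JK mulmx1.
Qed.

(** On cycles, a form whose value on two bands depends only on their generators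
    vanishes. Modulo such forms the symmetrized Seifert form can be made zero above
    the diagonal; below it there remains the skew form of the generators, and on the
    diagonal minus the sign of the crossing. *)
Definition triangular_form : 'M[int]_N :=
  \matrix_(k, l) ((l < k)%N%:R * chain_form int n (ltr k).1 (ltr l).1
                   + (k == l)%:R * (-1) ^+ (ltr k).2).

Lemma triangular_form_unit : triangular_form \in unitmx.
Proof.
rewrite unitmxE det_trig.
  rewrite (eq_bigr (fun k => (-1) ^+ (ltr k).2)) => [|k _].
    by apply: rpred_prod => k _; rewrite unitrX // unitrN1.
  by rewrite mxE ltnn mul0r add0r eqxx mul1r.
apply/is_trig_mxP => k l kl; rewrite mxE -val_eqE /=.
by rewrite ltnNge (ltnW kl) /= ltn_eqF // !mul0r.
Qed.

Lemma seifert_form_triangular r (B : 'M[int]_(r, N)) : seifert_basis B ->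
  B *m seifert_chain_form w *m B^T + (B *m seifert_chain_form w *m B^T)^T =
  B *m triangular_form *m B^T.
Proof.
move=> basisB.
have BD : B *m band_column = 0.
  by apply: kernel_basis_mul0 => x; rewrite -boundary_kernel; apply: basisB.
(* U is the part of the symmetrized form lying above the diagonal. *)
pose U : 'M[int]_n := \matrix_(i, j) ((j == i)%:R - (j == i.+1 :> nat)%:R).
have -> : triangular_form = seifert_chain_form w + (seifert_chain_form w)^T
    - band_column *m U *m band_column^T.
  apply/matrixP => k l; rewrite !entrywise [(_^T) k l]mxE.
  have -> : (band_column *m U *m band_column^T) k l = U (ltr k).1 (ltr l).1.
    rewrite mxE (bigD1 (ltr l).1) //= big1 ?addr0 => [|i /negbTE il]; last first.
      by rewrite ![band_column^T _ _]mxE [band_column _ _]mxE eq_sym il mulr0.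
    rewrite [band_column^T _ _]mxE [band_column l _]mxE eqxx mulr1.
    rewrite mxE (bigD1 (ltr k).1) //= big1 ?addr0 => [|i /negbTE ik]; last first.
      by rewrite [band_column _ _]mxE eq_sym ik mul0r.
    by rewrite [band_column _ _]mxE eqxx mul1r.
  rewrite !mxE; have [<-|kl] := eqVneq k l.
    rewrite ltnn !eqxx; case: (ltr k) => i [] /=; rewrite !mul0r; lia.
  case: (ltr k) => i e; case: (ltr l) => j f /=.
  have [lk|lk|/val_inj] := ltngtP l k; last by move=> e'; rewrite e' eqxx in kl.
    rewrite /= [_ == i]eq_sym; lia.
  rewrite /= [_ == i]eq_sym; lia.
rewrite !(mulmxBr, mulmxDr, mulmxBl, mulmxDl) !mulmxA BD !mul0mx subr0.
by rewrite !trmx_mul trmxK !mulmxA.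
Qed.

(** The solution [Y] of [triangular_form *m Y = band_column] by forward substitution:
    the row of a band involves only the bands before it, through their sum over each
    generator, which is the variation of the prefix. *)
Definition band_solution : 'M[int]_(N, n) :=
  \matrix_(k, j) ((-1) ^+ (ltr k).2 *
    (1%:M - chain_form int n *m variation int (take k w)) (ltr k).1 j).

Lemma variation_take m : (m <= N)%N ->
  forall i j, variation int (take m w) i j =
  \sum_(l < N | (l < m)%N) ((ltr l).1 == i)%:R * band_solution l j.
Proof.
elim: m => [_ i j|m ih mN i j]; first by rewrite take0 /variation mxE big_pred0.
pose d := ltr (Ordinal mN).
rewrite (take_nth d) // variation_rcons.
rewrite (bigD1 (Ordinal mN)) //=.
rewrite (eq_bigl (fun l : 'I_N => (l < m)%N)) => [|l]; last first.
  by rewrite -val_eqE /= ltnS; case: ltngtP.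
rewrite -ih ?(ltnW mN) // [band_solution _ _]mxE /= (tnth_nth d) /=.
set a := nth d w m; set x := variation _ _.
have -> : variation_mul x (letter_variation int a)
        = x + (-1) ^+ a.2 *: (delta_mx a.1 a.1 *m (1%:M - chain_form int n *m x)).
  by rewrite /variation_mul /letter_variation -!scalemxAl mulmxBr mulmx1 scalerBr addrA mulmxA.
rewrite addmx_entry addrC; congr (_ + _).
by rewrite [LHS]mxE delta_mx_mulE mulrCA.
Qed.

Lemma triangular_form_solution : triangular_form *m band_solution = band_column.
Proof.
apply/matrixP => k j; rewrite [RHS]mxE mxE.
transitivity (\sum_(l < N | (l < k)%N) chain_form int n (ltr k).1 (ltr l).1 * band_solution l j
              + (-1) ^+ (ltr k).2 * band_solution k j).
  rewrite [RHS]addrC (bigD1 k) //= [triangular_form _ _]mxE ltnn mul0r add0r eqxx mul1r.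
  congr (_ + _).
  rewrite [LHS](bigID (fun l : 'I_N => (l < k)%N)) /= [X in _ + X]big1 ?addr0; last first.
    move=> l /andP[lk /negbTE lk']; rewrite [triangular_form _ _]mxE lk' [k == l]eq_sym.
    by rewrite (negbTE lk) mul0r mul0r addr0 mul0r.
  apply: eq_big => [l|l /andP[lk lk']].
    by rewrite -val_eqE /=; case: ltngtP.
  by rewrite [triangular_form _ _]mxE lk' [k == l]eq_sym (negbTE lk) mul1r mul0r addr0.
rewrite mxE mulrA -signr_addb addbb mul1r.
have <- : (chain_form int n *m variation int (take k w)) (ltr k).1 j
  = \sum_(l < N | (l < k)%N) chain_form int n (ltr k).1 (ltr l).1 * band_solution l j.
  rewrite mxE; under eq_bigr => a _ do
    rewrite variation_take ?mulr_sumr ?(ltnW (ltn_ord k)) //.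
  rewrite exchange_big /=; apply: eq_bigr => l _.
  rewrite (bigD1 (ltr l).1) //= big1 ?addr0 ?eqxx ?mul1r // => a /negbTE al.
  by rewrite eq_sym al mul0r mulr0.
by rewrite !entrywise addrCA subrr addr0 mxE.
Qed.

Lemma variation_gram : band_column^T *m invmx triangular_form *m band_column = variation int w.
Proof.
rewrite -triangular_form_solution mulmxA mulmxKV ?triangular_form_unit //.
apply/matrixP => i j; rewrite -[w in RHS]take_size variation_take // mxE.
by apply: eq_big => [l|l _]; [rewrite ltn_ord|rewrite triangular_form_solution !mxE].
Qed.

Lemma det_seifert_matrix r (B : 'M[int]_(r, N)) (V := B *m seifert_chain_form w *m B^T) :
    (forall i : 'I_n, i \in [seq a.1 | a <- w]) -> seifert_basis B ->
  `|\det (V + V^T)| = `|\det (variation int w)|.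
Proof.
move=> full basisB; rewrite /V seifert_form_triangular // -variation_gram.
have pos (i : 'I_n) : exists k : 'I_N, (ltr k).1 = i.
  have /mapP[a /tnthP[k ->] ->] : i \in [seq a.1 | a <- in_tuple w] by apply: full.
  by exists k.
have [f fE] := choice pos.
apply: (@det_kernel_form _ _ _ B _ (\matrix_(i, k) (f i == k)%:R)).
- apply/matrixP => i j; rewrite !mxE (bigD1 (f i)) //= big1 ?addr0 => [|k /negbTE fk].
    by rewrite !mxE eqxx mul1r fE.
  by rewrite !mxE eq_sym fk mul0r.
- exact: triangular_form_unit.
- by move=> x; rewrite -boundary_kernel; apply: basisB.
Qed.

End Seifert.

(** The variation does not depend on the word that represents the braid, hence
    neither does the absolute value of the determinant. *)
Lemma closure_det_variation n (b : braid n) :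
  `|closure_det b| = `|\det (variation int (braid_repr b))|.
Proof.
have [r [V [[w [wb full [B basisB ->]]] ->]]] := closure_detP b.
rewrite det_seifert_matrix //; congr `|\det _|; apply: variation_braid_rel.
by apply/braid_ofP; rewrite braid_reprK.
Qed.

(** * Counting matrices of given determinant *)

Section RankOne.
Variables (F : comNzRingType) (n : nat).
Implicit Types (a : 'M[F]_n) (u : 'cV[F]_n) (v : 'rV[F]_n).

(** The variable row [v] becomes one row of a bordered determinant, which is linear
    in it. *)
Lemma det_bordered a u v : \det (a + u *m v) = \det (block_mx (1%:M : 'M_1) (- v) u a).
Proof.
have -> : block_mx (1%:M : 'M_1) (- v) u a =
    block_mx 1%:M 0 u 1%:M *m block_mx 1%:M (- v) 0 (a + u *m v).
  by rewrite mulmx_block !mulmx1 !mul1mx !mul0mx mulmxN ?mulmx0 !addr0 addrCA addNr addr0.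
by rewrite det_mulmx det_lblock det_ublock !det1 !mul1r.
Qed.

Lemma det_one_rank1 u v : \det (1%:M + u *m v) = 1 + (v *m u) 0 0.
Proof.
rewrite det_bordered.
have -> : block_mx (1%:M : 'M_1) (- v) u (1%:M : 'M_n) =
    block_mx (1%:M + v *m u) (- v) 0 1%:M *m block_mx 1%:M 0 u 1%:M.
  by rewrite mulmx_block !mulmx1 !mul1mx !mul0mx mulNmx ?mulmx0 !add0r addrK.
by rewrite det_mulmx det_lblock det_ublock !det1 !mulr1 det_mx11 entrywise mxE.
Qed.

Lemma det_rank1_affine a u v : exists b, forall k : F, \det (a + k *: (u *m v)) = \det a + k * b.
Proof.
exists (\det (block_mx (0 : 'M_1) (- v) u a)) => k.
rewrite scalemxAr det_bordered.
rewrite (@determinant_multilinear _ _ _ (block_mx (1%:M : 'M_1) 0 u a)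
  (block_mx (0 : 'M_1) (- v) u a) (lshift _ 0) 1 k).
- by rewrite det_lblock det1 !mul1r.
- rewrite /block_mx !rowKu !row_id scale1r scale_row_mx add_row_mx scaler0 addr0 add0r.
  by rewrite scalerN.
- rewrite /block_mx; apply/matrixP => i j; rewrite !mxE; case: splitP => // i' e.
  by move: (ltn_ord i'); rewrite -e.
- by apply/matrixP => i j; rewrite !mxE; case: splitP => // i' e; move: (ltn_ord i'); rewrite -e.
Qed.

End RankOne.

Section Twist.
Variables (F : fieldType) (n : nat).
Implicit Types (x : 'M[F]_n) (i j : 'I_n) (k t : F).
Local Notation om := (chain_form F n).

(** The effect on the variation of multiplying a braid by the power [k] of the
    generator [i], where [k] is allowed to be a scalar. *)
Definition twist k i x := variation_mul x (- k *: delta_mx i i).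

Lemma twistE k i x :
  twist k i x = x - k *: ((delta_mx i 0 : 'cV_n) *m ((delta_mx 0 i : 'rV_n) *m (1%:M - om *m x))).
Proof.
rewrite mulmxA mul_delta_mx /twist /variation_mul mulmxBr mulmx1 scalerBr opprB addrA addrAC mulmxA.
by rewrite !scaleNr !mulNmx opprK -!scalemxAl.
Qed.

Lemma twistD k t i x : twist k i (twist t i x) = twist (t + k) i x.
Proof.
rewrite /twist -variation_mulA; congr (variation_mul _ _).
rewrite /variation_mul -scalemxAr -!scalemxAl delta_form chain_form_diag scale0r !scaler0 subr0.
by rewrite -scalerDl opprD.
Qed.

Lemma twist0 i x : twist 0 i x = x.
Proof. by rewrite /twist oppr0 scale0r variation_mulx0. Qed.

Lemma twistK k i : cancel (twist k i) (twist (- k) i).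
Proof. by move=> x; rewrite twistD subrr twist0. Qed.

Lemma seifert_symmetric_twist k i x : seifert_symmetric x -> seifert_symmetric (twist k i x).
Proof.
by move=> hx; apply: seifert_symmetric_mul => //; apply: seifert_symmetric_diag.
Qed.

Lemma twist_natE (w : braid_word n) i (m : nat) :
  twist m%:R i (variation F w) = variation F (w ++ nseq m (i, true)).
Proof.
elim: m => [|m ih]; first by rewrite cats0 twist0.
rewrite -addn1 nseqD catA variation_cat -ih variation1 natrD -twistD.
by rewrite /letter_variation /= expr1 /twist.
Qed.

(** Twisting is affine in [x] and acts on the left of the direction, so that it maps a
    line of rank one direction to such a line. *)
Lemma twist_rank1_line t j x (u : 'cV_n) (v : 'rV_n) : exists u' : 'cV_n, forall k,
  twist t j (x + k *: (u *m v)) = twist t j x + k *: (u' *m v).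
Proof.
exists (u + t *: (delta_mx j j *m om *m u)) => k.
rewrite /twist /variation_mul mulmxDr scaleNr !mulNmx !opprK -!scalemxAl -!scalemxAr.
rewrite mulmxDl scalerDr scalemxAl !mulmxA -!scalemxAl.
rewrite !scalerA mulrC; apply/matrixP => a b; rewrite !entrywise; ring.
Qed.

(** The determinant of the successive twists of [x] along [s], seen as a function of
    their exponents, is a multi-affine polynomial: here it is the constant [c]. *)
Fixpoint det_constant (c : F) (s : seq 'I_n) x : Prop :=
  if s is i :: s' then forall k, det_constant c s' (twist k i x) else \det x = c.

Lemma det_constant_line c s x (u : 'cV_n) (v : 'rV_n) k1 k2 : k1 != k2 ->
    det_constant c s (x + k1 *: (u *m v)) -> det_constant c s (x + k2 *: (u *m v)) ->
  forall k, det_constant c s (x + k *: (u *m v)).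
Proof.
move=> k12; elim: s x u => [|i s ih] x u /=.
  have [b detE] := det_rank1_affine x u v; rewrite !detE => h1 h2 k.
  have b0 : (k1 - k2) * b = 0.
    by rewrite mulrBl -[_ - _](addrKA (\det x)) ![_ + \det x]addrC h1 h2 subrr.
  move/eqP: b0; rewrite mulf_eq0 subr_eq0 (negbTE k12) /= => /eqP b0.
  by rewrite detE -h1 b0 !mulr0.
move=> h1 h2 k t; have [u' lineE] := twist_rank1_line t i x u v.
by rewrite lineE; apply: ih; rewrite -lineE.
Qed.

Lemma det_constant_twist c s i x k1 k2 : k1 != k2 ->
    det_constant c s (twist k1 i x) -> det_constant c s (twist k2 i x) ->
  det_constant c (i :: s) x.
Proof.
move=> k12; rewrite !twistE -!scaleNr => h1 h2 k; rewrite twistE -scaleNr.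
by apply: det_constant_line h1 h2 _; rewrite eqr_opp.
Qed.

Lemma det_constant_drop c s1 s2 x : det_constant c (s1 ++ s2) x -> det_constant c s2 x.
Proof.
by elim: s1 x => //= i s ih x /(_ 0); rewrite twist0; apply: ih.
Qed.

Definition chain_word m : seq 'I_n := flatten (nseq m (enum 'I_n)).

Lemma det_constant_chain_step c m x : det_constant c (chain_word m.+1) x ->
  forall k i, det_constant c (chain_word m) (twist k i x).
Proof.
move=> + k i; have : i \in enum 'I_n by rewrite mem_enum.
rewrite /chain_word /= => /splitPr[s1 s2].
rewrite -catA => /det_constant_drop /(_ k); exact: det_constant_drop.
Qed.

Lemma det_constant_chain c m x : det_constant c (chain_word m) x -> \det x = c.
Proof. by rewrite -[chain_word m]cats0 => /det_constant_drop. Qed.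

Lemma mulmx_basis p (A : 'M[F]_(p, n)) a i : (A *m (delta_mx i 0 : 'cV_n)) a 0 = A a i.
Proof. by rewrite -colE mxE. Qed.

(** Take a vector [y] of the left kernel of [x] with nonzero coordinate [i]. By
    symmetry [x^T = x (1 + omega x^T)], so [y] kills the columns of [x^T] too, and the
    basis row [i] is not a combination of the rows of [x]. The row [r] added by the
    twist is congruent to it modulo those rows. Hence the left kernel loses [y]
    without gaining anything. *)
Lemma rank_twist x : seifert_symmetric x -> \det x = 0 ->
  exists i, (\rank x < \rank (twist 1 i x))%N.
Proof.
move=> symx det0.
have ker0 : kermx x != 0.
  by rewrite kermx_eq0 row_free_unit unitmxE unitfE det0 eqxx.
have [a [i kai]] : exists a, exists i, kermx x a i != 0.
  apply: contrapT => h; case/negP: ker0; apply/eqP/matrixP => a i; rewrite [RHS]mxE.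
  by apply: contrapT => /eqP kai; apply: h; exists a, i.
exists i; pose e : 'rV[F]_n := delta_mx 0 i; pose r := e *m (1%:M - om *m x).
have eNx (z : 'rV_n) : e <> z *m x.
  move=> ez; case/negP: kai; rewrite -mulmx_basis.
  have -> : delta_mx i 0 = x *m (1%:M + om *m x^T) *m z^T :> 'cV_n.
    rewrite mulmxDr mulmx1 mulmxA -symx addrC subrK -trmx_mul -ez trmx_delta //.
  by rewrite !mulmxA mulmx_ker !mul0mx mxE.
have eE : e = r + e *m om *m x by rewrite /r mulmxBr mulmx1 mulmxA subrK.
have mulT (z : 'rV_n) : z *m twist 1 i x = z *m x - z 0 i *: r.
  rewrite twistE scale1r mulmxBr mulmxA -/e -/r; congr (_ - _).
  by rewrite [z *m _]mx11_scalar mul_scalar_mx mulmx_basis.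
suff : (kermx (twist 1 i x) < kermx x)%MS.
  by move=> /rank_ltmx; rewrite !mxrank_ker; have := rank_leq_row x; lia.
rewrite ltmxE; apply/andP; split.
  apply/row_subP => b; apply/sub_kermxP; set z := row b _.
  have : z *m twist 1 i x = 0 by rewrite -row_mul mulmx_ker row0.
  rewrite mulT => /eqP; rewrite subr_eq0 => /eqP zx.
  have [z0|z0] := eqVneq (z 0 i) 0; first by rewrite zx z0 scale0r.
  case: (eNx ((z 0 i)^-1 *: z + e *m om)).
  by rewrite mulmxDl -scalemxAl zx scalerA mulVf // scale1r -eE.
apply/negP => /row_subP/(_ a)/sub_kermxP; rewrite mulT -row_mul mulmx_ker row0 sub0r mxE.
move/eqP; rewrite oppr_eq0 scaler_eq0 (negbTE kai) /= => /eqP r0.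
by case: (eNx (e *m om)); rewrite -[X in _ = X]add0r -r0 -eE.
Qed.

(** [chain_form] is zero on the diagonal, so only the diagonal entry of [x^-1] enters
    the matrix determinant lemma. *)
Lemma det_twist_unit k i x : \det x != 0 ->
  \det (twist k i x) = \det x * (1 - k * invmx x i i).
Proof.
move=> detx; have ux : x \in unitmx by rewrite unitmxE unitfE.
rewrite twistE; set e : 'cV_n := delta_mx i 0; set e' : 'rV_n := delta_mx 0 i.
have -> : x - k *: (e *m (e' *m (1%:M - om *m x)))
    = (1%:M + (- k *: e) *m (e' *m (invmx x - om))) *m x.
  rewrite mulmxDl mul1mx -!scalemxAl scaleNr; congr (_ - _ *: _).
  by rewrite -!mulmxA mulmxBl mulVmx.
rewrite det_mulmx mulrC; congr (_ * _); rewrite det_one_rank1 -scalemxAr mxE mulNr.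
congr (1 - k * _).
by rewrite -rowE -colE !mxE subrr subr0.
Qed.

Lemma invmx_symmetric x : seifert_symmetric x -> \det x != 0 ->
  invmx x - (invmx x)^T = om.
Proof.
move=> symx detx; have ux : x \in unitmx by rewrite unitmxE unitfE.
have uxT : x^T \in unitmx by rewrite unitmx_tr.
have := congr1 (fun m => invmx x *m m *m invmx x^T) symx.
by rewrite mulmxBr mulmxBl mulVmx // mul1mx mulmxK // !mulmxA mulVmx // mul1mx mulmxK // trmx_inv.
Qed.

(** By the symmetry of [x^-1] up to [chain_form], the Sherman-Morrison formula for the
    twist adds to [x^-1] a symmetric matrix of rank one, which has squares on its
    diagonal. *)
Lemma invmx_twist_diag i j x : seifert_symmetric x -> \det x != 0 -> invmx x i i = 0 ->
  invmx (twist 1 i x) j j = invmx x j j + invmx x j i ^+ 2.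
Proof.
move=> symx detx zii; have ux : x \in unitmx by rewrite unitmxE unitfE.
have uT : twist 1 i x \in unitmx.
  by rewrite unitmxE unitfE det_twist_unit // zii mulr0 subr0 mulr1.
set Z := invmx x in zii *.
pose E : 'M[F]_n := delta_mx i i.
suff -> : invmx (twist 1 i x) = Z + Z *m E *m Z^T.
  rewrite entrywise -mulmxA; congr (_ + _); rewrite mxE (bigD1 i) //= big1 ?addr0.
    by rewrite /E delta_mx_mulE eqxx mul1r mxE.
  by move=> l /negbTE li; rewrite /E delta_mx_mulE eq_sym li mul0r mulr0.
apply: (can_inj (mulKmx uT)); rewrite mulmxV //.
have ZT : Z^T = Z - om by rewrite -(invmx_symmetric symx detx) opprB addrCA subrr addr0.
have xZ : twist 1 i x *m Z = 1%:M - E *m Z^T.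
  rewrite /twist /variation_mul scaleN1r ZT !mulNmx opprK !mulmxDl mulmxV //.
  by rewrite -[_ *m x *m Z]mulmxA mulmxV // mulmx1 mulmxBr mulNmx opprB addrAC -addrA.
rewrite mulmxDr !mulmxA xZ mulmxBl mul1mx delta_form mxE zii scale0r subr0.
by rewrite subrK.
Qed.

(** Each round through the generators raises the rank until it is full. *)
Lemma det_constant0_false m x : seifert_symmetric x -> (n <= m + \rank x)%N ->
  ~ det_constant 0 (chain_word m) x.
Proof.
elim: m x => [|m ih] x symx le_n const.
  have [i] := rank_twist symx (det_constant_chain const).
  by have := rank_leq_row (twist 1 i x); lia.
have [i lt_rank] := rank_twist symx (det_constant_chain const).
apply: (ih (twist 1 i x)); first exact: seifert_symmetric_twist.
  by lia.
exact: det_constant_chain_step.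
Qed.

(** If the determinant stays equal to [c], then the inverse of [x] has zero diagonal,
    and so has the inverse of its twist by the generator [i]. The latter diagonal
    contains the squares of the entries of the column [i], so [x^-1 = 0]. *)
Lemma det_constant_neq0_false c x : (0 < n)%N -> c != 0 -> seifert_symmetric x ->
  ~ det_constant c (chain_word 2) x.
Proof.
move=> n_gt0 c0 symx const.
have diag0 m y : det_constant c (chain_word m.+1) y ->
    \det y = c /\ forall i, invmx y i i = 0.
  move=> consty; have dety := det_constant_chain consty; split=> // i.
  have := det_constant_chain (det_constant_chain_step consty 1 i).
  rewrite det_twist_unit ?dety // => h; apply: (mulfI c0).
  by rewrite mulr0 -(subrr c) -{3}h; ring.
have [detx Zdiag] := diag0 _ _ const.
have detx0 : \det x != 0 by rewrite detx.
have Z0 : invmx x = 0.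
  apply/matrixP => j i; rewrite [RHS]mxE; apply/eqP; rewrite -sqrf_eq0; apply/eqP.
  have [_ /(_ j)] := diag0 _ _ (det_constant_chain_step const 1 i).
  by rewrite invmx_twist_diag // Zdiag add0r.
have : x *m invmx x = 1%:M by rewrite mulmxV // unitmxE unitfE.
rewrite Z0 mulmx0 => /matrixP/(_ (Ordinal n_gt0) (Ordinal n_gt0))/eqP.
by rewrite !mxE eqxx eq_sym oner_eq0.
Qed.

Lemma det_constant_false c x : (0 < n)%N -> seifert_symmetric x ->
  ~ det_constant c (chain_word n.+1) x.
Proof.
move=> n_gt0 symx; have [->|c0] := eqVneq c 0.
  by apply: det_constant0_false => //; lia.
have -> : chain_word n.+1 = chain_word n.-1 ++ chain_word 2.
  by rewrite /chain_word -flatten_cat -nseqD; congr (flatten (nseq _ _)); lia.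
by move/det_constant_drop; apply: det_constant_neq0_false.
Qed.

Lemma size_chain_word m : size (chain_word m) = (m * n)%N.
Proof.
rewrite /chain_word size_flatten /shape map_nseq sumn_nseq -cardE card_ord mulnC //.
Qed.

End Twist.

Section Count.
Variables (F : finFieldType) (n : nat) (H : {set 'M[F]_n}).
Hypothesis n_gt0 : (0 < n)%N.
Hypothesis twistH : forall k i x, x \in H -> twist k i x \in H.
Hypothesis symH : forall x, x \in H -> seifert_symmetric x.

Let level c s : {set 'M[F]_n} := [set x in H | `[< det_constant c s x >]].

(** By [det_constant_twist], for each [x] outside the level of [i :: s] at most one
    twist by [i] falls in the level of [s]. Sum over [x] in [H], using that each twist
    permutes [H]. *)
Lemma level_cons c i s :
  (#|level c s| * #|F| <= #|level c (i :: s)| * #|F| + #|H|)%N.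
Proof.
have twistHE k x : (twist k i x \in H) = (x \in H).
  by apply/idP/idP => [/(twistH (- k) i)|/twistH //]; rewrite twistK.
have count k : #|level c s| = (\sum_(x in H) `[< det_constant c s (twist k i x) >])%N.
  rewrite -(card_preimset _ (can_inj (twistK k i))) -sum1_card big_mkcond /= [RHS]big_mkcond /=.
  by apply: eq_bigr => x _; rewrite !inE twistHE; case: (x \in H); case: asboolP.
have -> : (#|level c s| * #|F|
    = \sum_(x in H) #|[pred k | `[< det_constant c s (twist k i x) >]]|)%N.
  rewrite mulnC -sum_nat_const (eq_bigr _ (fun k _ => count k)) exchange_big /=.
  apply: eq_bigr => x _; rewrite -sum1_card [RHS]big_mkcond /=.
  by apply: eq_bigr => k _; rewrite inE; case: asboolP.
have -> : (#|level c (i :: s)| * #|F| + #|H|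
    = \sum_(x in H) (`[< det_constant c (i :: s) x >] * #|F| + 1))%N.
  rewrite big_split /= sum1_card -big_distrl /=; congr (_ * _ + _)%N.
  rewrite -sum1_card big_mkcond /= [RHS]big_mkcond /=.
  by apply: eq_bigr => x _; rewrite inE; case: (x \in H); case: asboolP.
apply: leq_sum => x _; case: asboolP => [h|h].
  by rewrite mul1n (leq_trans (max_card _)) // leq_addr.
rewrite mul0n add0n; apply/card_le1_eqP => k1 k2; rewrite !inE => /asboolP h1 /asboolP h2.
apply: contrapT => /eqP k12; apply: h.
by apply: det_constant_twist k12 (asboolW h2) (asboolW h1).
Qed.

(** The level of the empty sequence is the set to be counted, and that of the long
    enough sequence [chain_word n n.+1] is empty. *)
Lemma card_det_level c : (#|[set x in H | \det x == c]| * #|F| <= n.+1 * n * #|H|)%N.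
Proof.
have -> : [set x in H | \det x == c] = level c [::].
  by apply/setP => x; rewrite !inE; congr (_ && _); apply/eqP/asboolP.
rewrite -(size_chain_word n n.+1).
have -> : (size (chain_word n n.+1) * #|H| =
   #|level c (chain_word n n.+1)| * #|F| + size (chain_word n n.+1) * #|H|)%N.
  rewrite (_ : level _ _ = finset.set0) ?cards0 //; apply/setP => x; rewrite !inE.
  by apply/negP => /andP[/symH symx /asboolP]; exact: det_constant_false.
elim: (chain_word n n.+1) => [|i s ih]; first by rewrite addn0.
have := level_cons c i s; move: ih => /=; lia.
Qed.

Lemma card_det_levels (cs : seq F) :
  (#|[set x in H | \det x \in cs]| * #|F| <= size cs * (n.+1 * n * #|H|))%N.
Proof.
elim: cs => [|c cs ih].
  by rewrite (_ : [set x in _ | _] = finset.set0) ?cards0 //; apply/setP => x; rewrite !inE andbF.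
have -> : [set x in H | \det x \in c :: cs]
    = [set x in H | \det x == c] :|: [set x in H | \det x \in cs].
  by apply/setP => x; rewrite !inE; case: (x \in H).
apply: leq_trans
  (_ : (#|[set x in H | \det x == c]| + #|[set x in H | \det x \in cs]|) * #|F| <= _)%N.
  by rewrite leq_mul2r; apply/orP; right; rewrite cardsU leq_subr.
by rewrite mulnDl /= mulSn; apply: leq_add => //; exact: card_det_level.
Qed.

End Count.

(** * Random walks on finite quotients *)

Local Open Scope classical_set_scope.

Section Walk.
Variables (R : realType) (G : groupType) (mu : G -> R) (D : seq G).
Implicit Types (f : G -> R) (A : set G) (k : nat).

(** The expectation of [f] after [k] steps, conditioning on the last step: a finite
    sum over [D], which stands for the support of [mu]. *)
Fixpoint walk_mean k f : R :=
  if k is k'.+1 then \sum_(h <- D) mu h * walk_mean k' (fun g => f (g * h)%g) else f 1%g.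

(** After [k] steps the walk visits finitely many points. This is what allows
    infinite sums over the group to be exchanged with the expectation. *)
Lemma walk_mean_support k :
  exists r : seq G, forall f f', {in r, f =1 f'} -> walk_mean k f = walk_mean k f'.
Proof.
elim: k => [|k [r ih]]; first by exists [:: 1%g] => f f' /(_ 1%g) /= ->; rewrite ?inE.
exists [seq (g * h)%g | g <- r, h <- D] => f f' ff' /=.
apply: eq_big_seq => h hD; congr (_ * _); apply: ih => g gr.
by apply: ff'; apply/allpairsP; exists (g, h).
Qed.

Lemma eq_walk_mean k f f' : f =1 f' -> walk_mean k f = walk_mean k f'.
Proof. by move=> ff'; have [r] := walk_mean_support k; apply=> g _. Qed.

Lemma walk_mean_sum k (I : Type) (s : seq I) (P : pred I) (F : I -> G -> R) :
  walk_mean k (fun g => \sum_(i <- s | P i) F i g) = \sum_(i <- s | P i) walk_mean k (F i).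
Proof.
elim: k F => [//|k ih] F /=; rewrite exchange_big /=; apply: eq_bigr => h _.
by rewrite ih mulr_sumr.
Qed.

Hypothesis mu_ge0 : forall g, 0 <= mu g.
Hypothesis mu_sum : \sum_(h <- D) mu h = 1.

Lemma walk_mean_const k c : walk_mean k (fun=> c) = c.
Proof. by elim: k => //= k ->; rewrite -mulr_suml mu_sum mul1r. Qed.

Lemma ler_walk_mean k f f' : (forall g, f g <= f' g) -> walk_mean k f <= walk_mean k f'.
Proof.
elim: k f f' => [|k ih] f f' ff' /=; first exact: ff'.
by apply: ler_sum => h _; apply: ler_wpM2l => //; apply: ih.
Qed.

Hypothesis uniqD : uniq D.
Hypothesis suppD : forall g, mu g != 0 -> g \in D.

Lemma conv_powE k g : conv_pow mu k g = walk_mean k (fun g' => (g' == g)%:R).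
Proof.
elim: k g => [|k ih] g; first by rewrite /= eq_sym.
rewrite /conv_pow iterS -/(conv_pow mu k) /convolution /= (fsbigE D) //=; last first.
  by move=> h _; apply: contraNeq; rewrite mulf_eq0 negb_or => /andP[_]; apply: suppD.
rewrite big_mkcond /=; apply: eq_bigr => h _; rewrite in_setT ih mulrC; congr (_ * _).
by apply: eq_walk_mean => g'; rewrite -(can_eq (mulgK h)) mulgVK.
Qed.

(** On the points that the walk can visit, the indicator function of [A] is a finite
    sum of indicator functions of points. *)
Lemma sum_conv_pow k A : \sum_(g \in A) conv_pow mu k g = walk_mean k (fun g => (g \in A)%:R).
Proof.
have [r hr] := walk_mean_support k.
have conv0 g : g \notin r -> conv_pow mu k g = 0.
  move=> gr; rewrite conv_powE -[RHS](walk_mean_const k); apply: hr => g' g'r.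
  by case: eqP => // e; rewrite -e g'r in gr.
rewrite (fsbigE [seq g <- undup r | g \in A]); first last.
- by move=> g Ag; rewrite mem_filter mem_undup mem_set //= => /conv0.
- by move=> g /=; rewrite mem_filter => /andP[/set_mem].
- by rewrite filter_uniq // undup_uniq.
rewrite big_filter_cond (eq_bigr _ (fun g _ => conv_powE k g)) -walk_mean_sum.
apply: hr => g gr; rewrite big_mkcond /= (bigD1_seq g) ?undup_uniq ?mem_undup //= eqxx.
rewrite big1 ?addr0 => [|g' /negbTE g'g]; first by case: (g \in A).
by rewrite eq_sym g'g; case: ifP.
Qed.

(* [phi] is the orbit map of a right action of the group on a finite set. *)
Variables (X : finType) (phi : G -> X).
Hypothesis phiM : forall g g' h, phi g = phi g' -> phi (g * h)%g = phi (g' * h)%g.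

Definition fiber_mass k (x : X) : R := walk_mean k (fun g => (phi g == x)%:R).

Lemma fiber_mass_ge0 k x : 0 <= fiber_mass k x.
Proof. by rewrite -[X in X <= _](walk_mean_const k); apply: ler_walk_mean => g. Qed.

Lemma sum_fiber_mass k (B : {set X}) :
  \sum_(x in B) fiber_mass k x = walk_mean k (fun g => (phi g \in B)%:R).
Proof.
rewrite -walk_mean_sum; apply: eq_walk_mean => g.
rewrite big_mkcond (bigD1 (phi g)) //= eqxx big1 ?addr0 => [|x /negbTE xg].
  by case: (_ \in _).
by rewrite eq_sym xg; case: ifP.
Qed.

Lemma sum_fiber_mass_le1 k (P : pred X) : \sum_(x | P x) fiber_mass k x <= 1.
Proof.
have -> : \sum_(x | P x) fiber_mass k x = \sum_(x in [set x | P x]%SET) fiber_mass k x.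
  by apply: eq_bigl => x; rewrite inE.
rewrite sum_fiber_mass -[X in _ <= X](walk_mean_const k).
by apply: ler_walk_mean => g; case: (_ \in _); rewrite ?ler01.
Qed.

Lemma fiber_massS k g :
  fiber_mass k.+1 (phi g) = \sum_(h <- D) mu h * fiber_mass k (phi (g * h^-1)%g).
Proof.
apply: eq_bigr => h _; congr (_ * _); apply: eq_walk_mean => g'; congr (nat_of_bool _)%:R.
apply/eqP/eqP => [e|e]; first by rewrite -(phiM h^-1 e) mulgK.
by rewrite (phiM h e) mulgVK.
Qed.

Definition word_weight (s : seq G) := \prod_(h <- s) mu h.

(** If the masses are bounded by [m] from time [k] on, a mass close to [m] at a later
    time forces masses close to [m] at all points from which a word of fixed weight
    leads there, since it is an average of such masses. *)
Lemma word_deficit m k (s : seq G) g :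
    (forall h, h \in s -> h \in D) ->
    (forall k' x, (k <= k')%N -> fiber_mass k' x <= m) ->
  word_weight s * (m - fiber_mass k (phi (g * (\prod_(h <- s) h)^-1)%g)) <=
  m - fiber_mass (k + size s) (phi g).
Proof.
elim: s k => [|h s ih] k sD le_m.
  by rewrite /word_weight !big_nil invg1 mulg1 mul1r addn0.
rewrite /word_weight !big_cons addnS -addSn.
apply: le_trans (ih k.+1 _ _); last first.
- by move=> k' x kk'; apply: le_m; apply: ltnW.
- by move=> h' h's; apply: sD; rewrite inE h's orbT.
rewrite [mu h * _]mulrC -mulrA /word_weight.
apply: ler_wpM2l; first by apply: prodr_ge0 => h' _.
rewrite fiber_massS -[m in X in _ <= X]mul1r -mu_sum mulr_suml -sumrB.
rewrite (bigD1_seq h) /= ?sD ?mem_head // -mulrBr invMg mulgA lerDl.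
by apply: sumr_ge0 => h' _; rewrite -mulrBr mulr_ge0 // subr_ge0 le_m.
Qed.

Hypothesis nondeg : forall g : G, exists s : seq G,
  [/\ s != [::], all (fun h => mu h != 0) s & g = (\prod_(h <- s) h)%g].

(** Padding a word with copies of the loop [e] gives words of any large length up to
    an error less than the length of [e]. Lengths cannot be prescribed exactly: the
    walk may be periodic. *)
Lemma word_of_length (e : seq G) : e != [::] -> all (fun h => mu h != 0) e ->
    (\prod_(h <- e) h)%g = 1%g -> forall g : G, exists t0, forall t, (t0 <= t)%N ->
  exists s : seq G, [/\ all (fun h => mu h != 0) s, g = (\prod_(h <- s) h)%g,
    (t <= size s)%N & (size s < t + size e)%N].
Proof.
move=> e0 mue prode g; have [s [_ mus ->]] := nondeg g.
have e_gt0 : (0 < size e)%N by rewrite lt0n size_eq0.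
exists (size s) => t le_t.
pose j := ((t - size s + (size e).-1) %/ size e)%N.
exists (s ++ flatten (nseq j e)); split.
- rewrite all_cat mus /=; elim: j => //= j ih; by rewrite all_cat mue.
- rewrite big_cat /= [X in (_ * X)%g](_ : _ = 1%g) ?mulg1 //.
  by elim: j => [|j ih] /=; rewrite ?big_nil // big_cat /= prode ih mulg1.
- rewrite size_cat size_flatten /shape map_nseq sumn_nseq.
  have := divn_eq (t - size s + (size e).-1) (size e); rewrite -/j.
  have := ltn_pmod (t - size s + (size e).-1) e_gt0; lia.
- rewrite size_cat size_flatten /shape map_nseq sumn_nseq.
  have := divn_eq (t - size s + (size e).-1) (size e); rewrite -/j.
  have := ltn_pmod (t - size s + (size e).-1) e_gt0; lia.
Qed.

Definition walk_image : {set X} := [set x | `[< exists g, phi g = x >]]%SET.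

Lemma fiber_mass_notin k x : x \notin walk_image -> fiber_mass k x = 0.
Proof.
move=> xH; rewrite -[RHS](walk_mean_const k); apply: eq_walk_mean => g.
by case: eqP => // e; case/negP: xH; rewrite inE; apply/asboolP; exists g.
Qed.

(** Apply [word_deficit] to the point [x] and, for each point [y] of the image, to a
    word leading from [y] to [x] whose length lies in a window of size [size e]
    common to all pairs of points. Then all points have mass close to [m] at some
    time of a window of [size e] steps. The total mass over the window being
    [size e], the number [m] cannot exceed [size e] divided by the number of points
    unless the mass of [x] is smaller by a definite amount. *)
Lemma fiber_mass_contraction (e : seq G) : e != [::] -> all (fun h => mu h != 0) e ->
    (\prod_(h <- e) h)%g = 1%g ->
  exists W (d : R), [/\ 0 < d, d <= 1 & forall k m,
    (forall k' x, (k <= k')%N -> fiber_mass k' x <= m) ->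
    forall k' x, (k + W <= k')%N ->
    fiber_mass k' x <= m - d * (m - (size e)%:R / #|walk_image|%:R)].
Proof.
move=> e0 mue prode.
have /choice[rep repE] (x : X) : exists g, x \in walk_image -> phi g = x.
  case: (boolP (x \in walk_image)) => [|_]; last by exists 1%g.
  by rewrite inE => /asboolP[g gx]; exists g.
have /choice[t0 t0E] (p : X * X) := word_of_length e0 mue prode ((rep p.2)^-1 * rep p.1)%g.
pose T := (\max_p t0 p)%N.
have /choice[w wE] (p : X * X) := t0E p T (leq_bigmax p).
pose d := \big[Num.min/1]_(p : X * X) word_weight (w p).
have wD p h : h \in w p -> h \in D.
  by have [/allP mup _ _ _] := wE p => /mup; apply: suppD.
have d_gt0 : 0 < d.
  rewrite /d; apply: lt_bigmin => // p _.
  rewrite /word_weight big_seq; apply: prodr_gt0 => h hp.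
  by have [/allP/(_ _ hp) mup _ _ _] := wE p; rewrite lt_neqAle eq_sym mup mu_ge0.
have d_le1 : d <= 1 by rewrite /d bigmin_le_id.
have d_le p : d <= word_weight (w p) by rewrite /d; apply: bigmin_le_cond.
exists (T + size e)%N, d; split=> // k m le_m k' x kk'.
set q := _ / _; have m_ge0 : 0 <= m by apply: le_trans (le_m k x _); rewrite ?fiber_mass_ge0.
have [xH|xH] := boolP (x \in walk_image); last first.
  have -> : m - d * (m - q) = (1 - d) * m + d * q by ring.
  rewrite fiber_mass_notin // addr_ge0 // mulr_ge0 ?subr_ge0 //; first exact: ltW.
  by rewrite divr_ge0.
have H_gt0 : 0 < #|walk_image|%:R :> R.
  by rewrite ltr0n; apply/card_gt0P; exists x.
have deficit y : y \in walk_image -> 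
    d * (m - fiber_mass (k' - size (w (x, y))) y) <= m - fiber_mass k' x.
  move=> yH; have [_ prodw Tw wT] := wE (x, y).
  have kw : (k <= k' - size (w (x, y)))%N by clear -kk' wT; lia.
  have := @word_deficit m (k' - size (w (x, y))) (w (x, y)) (rep x) (wD _).
  rewrite -prodw /= invMg invgK mulgA mulgV mul1g !repE // subnK; last by clear -kk' wT; lia.
  move=> h; apply: le_trans (h _); last by move=> k'' z kk''; apply: le_m; apply: leq_trans kk''.
  by apply: ler_wpM2r => //; rewrite subr_ge0 le_m.
have total : \sum_(y in walk_image) fiber_mass (k' - size (w (x, y))) y <= (size e)%:R.
  apply: le_trans (_ : \sum_(r < size e) \sum_(y in walk_image) fiber_mass (k' - (T + r)) y <= _).
    rewrite exchange_big /=; apply: ler_sum => y yH.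
    have [_ _ Tw wT] := wE (x, y).
    have rw : (size (w (x, y)) - T < size e)%N by clear -Tw wT; lia.
    rewrite (bigD1 (Ordinal rw)) //= subnKC // lerDl.
    by apply: sumr_ge0 => r _; apply: fiber_mass_ge0.
  rewrite -[X in _ <= X%:R]card_ord -sumr_const.
  by apply: ler_sum => r _; apply: sum_fiber_mass_le1.
have : \sum_(y in walk_image) d * (m - fiber_mass (k' - size (w (x, y))) y) <=
    \sum_(y in walk_image) (m - fiber_mass k' x) by apply: ler_sum.
rewrite -mulr_sumr sumrB !sumr_const -[m *+ _]mulr_natl -[(m - _) *+ _]mulr_natl => h.
rewrite lerBrDr addrC -lerBrDr -(ler_pM2l H_gt0); apply: le_trans h.
rewrite mulrCA; apply: ler_wpM2l; first exact: ltW.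
by rewrite mulrBr lerB // /q mulrCA divff ?mulr1 // gt_eqF.
Qed.

(** Iterating the contraction, the excess over [size e / #|walk_image|] decreases
    geometrically. *)
Lemma fiber_mass_limsup (e : seq G) : e != [::] -> all (fun h => mu h != 0) e ->
    (\prod_(h <- e) h)%g = 1%g ->
  forall eps : R, 0 < eps -> exists K, forall k x, (K <= k)%N ->
  fiber_mass k x <= (size e)%:R / #|walk_image|%:R + eps.
Proof.
move=> e0 mue prode eps eps_gt0; set q := _ / _.
have [W [d [d_gt0 d_le1 contract]]] := fiber_mass_contraction e0 mue prode.
have q_ge0 : 0 <= q by rewrite divr_ge0.
have bound j k x : (j * W <= k)%N -> fiber_mass k x <= q + (1 - d) ^+ j.
  elim: j k x => [|j ih] k x.
    move=> _; rewrite expr0 ler_wpDl //.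
    by have := sum_fiber_mass_le1 k (pred1 x); rewrite big_pred1_eq.
  rewrite mulSn addnC => /(contract _ _ ih) /le_trans; apply.
  by rewrite -/q exprS; lra.
have [j jE] : exists j, (1 - d) ^+ j <= eps.
  have : (1 - d) ^+ j @[j --> \oo] --> (0 : R).
    by apply: cvg_expr; rewrite ger0_norm; lra.
  move=> /cvgrPdist_le/(_ eps eps_gt0)[j _ /(_ j (leqnn j))].
  rewrite /= sub0r normrN ger0_norm ?exprn_ge0 ?subr_ge0 // => h.
  by exists j.
by exists (j * W)%N => k x /bound /le_trans; apply; rewrite lerD2l.
Qed.

End Walk.

(** * Transience *)

Lemma finite_probability_support (R : realType) (G : groupType) (mu : G -> R) :
  finite_probability mu -> exists D : seq G,
    [/\ uniq D, forall g, mu g != 0 -> g \in D & \sum_(h <- D) mu h = 1].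
Proof.
move=> [_ fin sum1]; exists (enum_fset (fset_set [set g | mu g != 0])).
have suppD g : mu g != 0 -> g \in fset_set [set g | mu g != 0].
  by move=> mug; rewrite in_fset_set // mem_set.
split=> //; first exact: fset_uniq.
by rewrite -sum1 (fsbigTE (fset_set [set g | mu g != 0])) // => g; apply: contraNeq; apply: suppD.
Qed.

Lemma transient_subset (R : realType) (G : groupType) (mu : G -> R) (A B : set G) :
  finite_probability mu -> A `<=` B -> transient mu B -> transient mu A.
Proof.
move=> mu_prob AB; have [D [uniqD suppD sumD]] := finite_probability_support mu_prob.
have mu_ge0 := fprob_ge0 mu_prob.
move/cvgrPdist_le => transB; apply/cvgrPdist_le => eps eps_gt0.
apply: filterS (transB eps eps_gt0) => k; rewrite !sub0r !normrN => /ler_normlW leB.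
rewrite !(sum_conv_pow sumD uniqD suppD) in leB *.
rewrite ger0_norm; last first.
  by rewrite -[X in X <= _](walk_mean_const sumD k); apply: ler_walk_mean => // g.
apply: le_trans leB; apply: ler_walk_mean => // g.
have [/set_mem gA|//] := boolP (g \in A); by rewrite mem_set //; apply: AB.
Qed.

Lemma small_det_residue (p N : nat) n (b : braid n) : `|closure_det b| <= N%:Z ->
  \det (braid_variation 'F_p b) \in
    [seq (i%:Z - N%:Z)%:~R : 'F_p | i <- iota 0 (2 * N).+1].
Proof.
rewrite closure_det_variation => le_N.
rewrite /braid_variation -(map_variation (intmul 1 : {rmorphism int -> 'F_p})) det_map_mx.
set c := \det _ in le_N *; apply/mapP; exists (absz (c + N%:Z)); first by rewrite mem_iota; lia.
by congr (_%:~R); lia.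
Qed.

Section SmallDeterminants.
Variables (R : realType) (n : nat) (C : R) (mu : braid n -> R).
Hypothesis n_gt0 : (0 < n)%N.
Hypothesis mu_prob : finite_probability mu.
Hypothesis mu_nondeg : nondegenerate_probability mu.

(** The bound [M / p] on the limit of the probabilities holds for all primes [p], with
    [M] independent of [p]. *)
Lemma transient_small_det : transient mu [set b | `|closure_det b|%:~R < C].
Proof.
have [D [uniqD suppD sumD]] := finite_probability_support mu_prob.
have mu_ge0 := fprob_ge0 mu_prob.
have [e [e0 mue /esym prode]] := mu_nondeg 1%g.
pose N := Num.bound `|C|.
pose M := ((2 * N).+1 * (n.+1 * n) * size e)%N.
apply/cvgrPdist_le => eps eps_gt0.
have [p p_large p_pr] := prime_above (Num.bound (M%:R / (eps / 2))).
pose F := 'F_p; have cardF : #|F| = p by apply: card_Fp.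
have M_lt : M%:R <= p%:R * (eps / 2).
  have eps2 : 0 < eps / 2 by rewrite divr_gt0.
  rewrite -ler_pdivrMr //; apply/ltW/(lt_trans (archi_boundP _)).
    by rewrite divr_ge0 // ltW.
  by rewrite ltr_nat.
pose phi : braid n -> 'M[F]_n := braid_variation F (n := n).
have phiM g g' h : phi g = phi g' -> phi (g * h)%g = phi (g' * h)%g.
  by rewrite /phi !braid_variationM => ->.
pose H := walk_image phi.
have phiH b : phi b \in H by rewrite inE; apply/asboolP; exists b.
pose B : {set 'M[F]_n} :=
  [set x in H | \det x \in [seq (i%:Z - N%:Z)%:~R : F | i <- iota 0 (2 * N).+1]]%SET.
have cardB : (#|B| * p <= (2 * N).+1 * (n.+1 * n * #|H|))%N.
  have := @card_det_levels F n H n_gt0 _ _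
    [seq (i%:Z - N%:Z)%:~R : F | i <- iota 0 (2 * N).+1].
  rewrite size_map size_iota cardF; apply.
    move=> k i x; rewrite inE => /asboolP[b <-].
    rewrite -[k]natr_Zp /phi -[b]braid_reprK braid_variation_of twist_natE.
    by rewrite -braid_variation_of; apply: phiH.
  by move=> x; rewrite inE => /asboolP[b <-]; apply: seifert_symmetric_variation.
have H_gt0 : 0 < #|H|%:R :> R.
  by rewrite ltr0n; apply/card_gt0P; exists (phi 1%g); apply: phiH.
have [|K KE] := fiber_mass_limsup mu_ge0 sumD uniqD suppD phiM mu_nondeg e0 mue prode
  (eps := eps / 2 / #|H|%:R).
  by rewrite !divr_gt0.
exists K => // k /= Kk; rewrite sub0r normrN (sum_conv_pow sumD uniqD suppD).
rewrite ger0_norm; last first.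
  by rewrite -[X in X <= _](walk_mean_const sumD k); apply: ler_walk_mean => // g.
apply: (@le_trans _ _ (walk_mean mu D k (fun g => (phi g \in B)%:R))).
  apply: ler_walk_mean => // b; case: (boolP (b \in _)) => [/set_mem /= small|_].
    rewrite inE phiH small_det_residue // ltW //.
    have : `|closure_det b|%:~R < N%:R :> R.
      by apply: (lt_trans small); apply: le_lt_trans (ler_norm C) (archi_boundP _).
    by rewrite -[N%:R]/((N%:Z)%:~R) ltr_int.
  by case: (_ \in _).
rewrite -sum_fiber_mass.
apply: (@le_trans _ _ (\sum_(x in B) ((size e)%:R / #|H|%:R + eps / 2 / #|H|%:R))).
  by apply: ler_sum => x _; apply: KE.
rewrite sumr_const -[_ *+ _]mulr_natl -mulrDl mulrA ler_pdivrMr //.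
have cardBH : #|B|%:R <= #|H|%:R :> R.
  by rewrite ler_nat; apply/subset_leq_card/fintype.subsetP => x; rewrite inE => /andP[].
have p_gt0 : 0 < p%:R :> R by rewrite ltr0n prime_gt0.
have massB : #|B|%:R * (size e)%:R <= eps / 2 * #|H|%:R.
  rewrite -(ler_pM2l p_gt0); apply: (@le_trans _ _ (M%:R * #|H|%:R)); last first.
    by rewrite mulrA ler_wpM2r // ltW.
  rewrite -!natrM ler_nat /M.
  have := leq_mul2r (size e) (#|B| * p) ((2 * N).+1 * (n.+1 * n * #|H|)).
  by rewrite cardB orbT; lia.
by have := ler_wpM2r (ltW (divr_gt0 eps_gt0 (ltr0Sn R 1))) cardBH; lra.
Qed.

End SmallDeterminants.

Theorem theorem4 (R : realType) (n : nat) (C : R) (mu : braid n -> R) :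
  (1 <= n)%N ->
  finite_probability mu ->
  nondegenerate_probability mu ->
  (n.+1 = 3%N ->
    forall i : 'I_n, mu (sigma i) != 0 /\ mu ((sigma i)^-1)%g != 0) ->
  (odd n.+1 ->
    transient mu [set b | `|closure_det b|%:~R < C])
  /\
  (~~ odd n.+1 ->
    transient mu [set b | (0 < `|closure_det b|) /\ `|closure_det b|%:~R < C]
    /\
    transient mu [set b | closes_into_knot b /\ `|closure_det b|%:~R < C]).
Proof.
move=> n_gt0 mu_prob mu_nondeg _.
have small := transient_small_det C n_gt0 mu_prob mu_nondeg.
split=> [_ |_]; first exact: small.
by split; apply: transient_subset small => // b [].
Qed.
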